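(* Let $k \ge 1$ be an integer, let $p_d$ be a fixed probability density (the true data distribution) on a sample space $\mathcal{X}$, and for probability densities $p_{g_1},\dots,p_{g_k}$ on $\mathcal{X}$ (the generator distributions) let $D^* = (D^*_1,\dots,D^*_{k+1})$ be an optimal discriminator for $(p_d,p_{g_1},\dots,p_{g_k})$, i.e. a maximizer of $$\mathbb{E}_{x\sim p_d}\log D_{k+1}(x) + \sum_{i=1}^{k}\mathbb{E}_{x\sim p_{g_i}}\log D_i(x)$$ over all discriminators $D=(D_1,\dots,D_{k+1})$. Let $$C(p_{g_1},\dots,p_{g_k}) := \mathbb{E}_{x\sim p_d}\log D^*_{k+1}(x) + \sum_{i=1}^{k}\mathbb{E}_{x\sim p_{g_i}}\log\bigl(1-D^*_{k+1}(x)\bigr)$$ be the joint objective that the generators minimize, evaluated at the optimal discriminator. Then for all probability densities $p_{g_1},\dots,p_{g_k}$ on $\mathcal{X}$, $$C(p_{g_1},\dots,p_{g_k}) = KL\bigl(p_d \,\|\, p_{avg}\bigr) + k\, KL\Bigl(\tfrac{1}{k}\sum_{i=1}^k p_{g_i} \,\Big\|\, p_{avg}\Bigr) - (k+1)\log(k+1) + k\log k,$$ where $p_{avg}(x) = \dfrac{p_d(x)+\sum_{i=1}^k p_{g_i}(x)}{k+1}$. Moreover, $C$, as a function of $(p_{g_1},\dots,p_{g_k})$, attains its global minimum if $p_d = \frac{1}{k}\sum_{i=1}^k p_{g_i}$, and its value there is $-(k+1)\log(k+1)+k\log k$.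
   Context: The sample space $\mathcal{X}$ carries a fixed $\sigma$-finite reference measure, written $dx$ (e.g. Lebesgue measure on $\mathbb{R}^n$); all probability densities are with respect to it, equality of densities is almost everywhere, and $\mathbb{E}_{x\sim q} f(x) = \int q(x) f(x)\,dx$. A discriminator is a measurable function $D=(D_1,\dots,D_{k+1}):\mathcal{X}\to[0,1]^{k+1}$ with $\sum_{i=1}^{k+1}D_i(x)=1$ for every $x$; $D_{k+1}(x)$ is interpreted as the probability that $x$ comes from $p_d$, and $D_i(x)$ ($1\le i\le k$) as the probability that $x$ was produced by the $i$-th generator. No parametric restriction is placed on discriminators or generator distributions. $\log$ is the natural logarithm, with $\log 0=-\infty$ and $0\log 0 = 0\cdot(-\infty)=0$. $KL(p\|q)=\int p(x)\log\frac{p(x)}{q(x)}\,dx$ is the Kullback–Leibler divergence. *)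

(* Defs.v *)
From HB Require Import structures.
From mathcomp Require Import all_boot all_order all_algebra.
From mathcomp Require Import all_classical all_reals all_analysis.
Set Implicit Arguments.
Unset Strict Implicit.
Unset Printing Implicit Defensive.
Import Order.TTheory GRing.Theory Num.Theory.
Local Open Scope classical_set_scope.
Local Open Scope ring_scope.

(* Logarithms are taken in [\bar R] with [lne], so that
   [lne 0 = -oo]; the product of [\bar R] satisfies [0 * -oo = 0 * +oo = 0]. *)

Definition is_density (d : measure_display) (T : measurableType d)
    (R : realType) (mu : {measure set T -> \bar R}) (p : T -> R) : Prop :=
  [/\ measurable_fun [set: T] p, (forall x, 0 <= p x)
    & (\int[mu]_x (p x)%:E = 1)%E].

Definition expect (d : measure_display) (T : measurableType d)
    (R : realType) (mu : {measure set T -> \bar R}) (q : T -> R)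
    (f : T -> \bar R) : \bar R :=
  (\int[mu]_x ((q x)%:E * f x))%E.

(* The quotient is that of [\bar R], where [0^-1 = +oo]: where [q] vanishes the
   integrand is [+oo] if [p x > 0] and [0] if [p x = 0]. *)
Definition KL (d : measure_display) (T : measurableType d)
    (R : realType) (mu : {measure set T -> \bar R}) (p q : T -> R) : \bar R :=
  expect mu p (fun x => lne ((p x)%:E / (q x)%:E)%E).

(* Indices start at 0: the component for the real data (index k+1 in the usual
   1-based numbering) is [D ord_max]; [D (lift ord_max i)], whose index has the
   same value as [i : 'I_k], is the component for generator [i]. *)
Definition is_discriminator (d : measure_display) (T : measurableType d)
    (R : realType) (k : nat) (D : 'I_k.+1 -> T -> R) : Prop :=
  [/\ forall j, measurable_fun [set: T] (D j),
      forall j x, 0 <= D j x <= 1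
    & forall x, \sum_(j < k.+1) D j x = 1].

Definition discriminator_objective (d : measure_display)
    (T : measurableType d) (R : realType) (mu : {measure set T -> \bar R})
    (k : nat) (pd : T -> R) (pg : 'I_k -> T -> R) (D : 'I_k.+1 -> T -> R)
    : \bar R :=
  (expect mu pd (fun x => lne (D ord_max x)%:E)
   + \sum_(i < k) expect mu (pg i) (fun x => lne (D (lift ord_max i) x)%:E))%E.

Definition is_optimal_discriminator (d : measure_display)
    (T : measurableType d) (R : realType) (mu : {measure set T -> \bar R})
    (k : nat) (pd : T -> R) (pg : 'I_k -> T -> R) (D : 'I_k.+1 -> T -> R)
    : Prop :=
  is_discriminator D /\
  forall D' : 'I_k.+1 -> T -> R, is_discriminator D' ->
    (discriminator_objective mu pd pg D'
       <= discriminator_objective mu pd pg D)%E.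

Definition generator_objective (d : measure_display)
    (T : measurableType d) (R : realType) (mu : {measure set T -> \bar R})
    (k : nat) (pd : T -> R) (pg : 'I_k -> T -> R) (D : 'I_k.+1 -> T -> R)
    : \bar R :=
  (expect mu pd (fun x => lne (D ord_max x)%:E)
   + \sum_(i < k) expect mu (pg i) (fun x => lne (1 - D ord_max x)%:E))%E.

Definition gen_mean (T : Type) (R : realType) (k : nat)
    (pg : 'I_k -> T -> R) (x : T) : R :=
  k%:R^-1 * \sum_(i < k) pg i x.

Definition p_avg (T : Type) (R : realType) (k : nat)
    (pd : T -> R) (pg : 'I_k -> T -> R) (x : T) : R :=
  (pd x + \sum_(i < k) pg i x) / k.+1%:R.

(* Main.v *)
(* Write [s = pd + \sum_i pg_i] and [xlog p s = p ln (p / s)]. For [0 <= p <= s]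
   the inequality [ln u <= u - 1] at [u = s D / p] gives
   [p ln D <= xlog p s + (s D - p)], with equality only if [s D = p]. Integrated
   and summed over the components of a discriminator, the slack [s D - p]
   cancels, so the discriminator objective is at most the sum of the
   [\int xlog p_j s], a finite value reached at [D_j = p_j / s]. For an
   optimal [D] the termwise inequalities are therefore equalities of integrals,
   which forces [s D_j = p_j] almost everywhere. The generator objective is then
   [\int xlog pd s + \int xlog G s] with [G = \sum_i pg_i], and both
   Kullback-Leibler terms reduce to these integrals by homogeneity. The minimum
   follows from Gibbs' inequality. *)
Require Import Defs.
From HB Require Import structures.
From mathcomp Require Import all_boot all_order all_algebra.
From mathcomp Require Import all_classical all_reals all_analysis.
From mathcomp Require Import measurable_realfun ring.
Set Implicit Arguments.
Unset Strict Implicit.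
Unset Printing Implicit Defensive.
Import Order.TTheory GRing.Theory Num.Theory.
Local Open Scope classical_set_scope.
Local Open Scope ring_scope.

(** * Logarithm bounds, measurability, comparison of integrals and finite sums *)

Lemma ln_lt_subr1 (R : realType) (x : R) : 0 < x -> x != 1 -> ln x < x - 1.
Proof.
move=> x0 x1; rewrite -ltr_expR lnK ?posrE//.
have := @expR_gt1Dx R (x - 1); rewrite subr_eq0 x1 => /(_ isT).
by rewrite addrC subrK.
Qed.

Lemma ln_le_subr1 (R : realType) (x : R) : 0 < x -> ln x <= x - 1.
Proof.
move=> x0; have [->|x1] := eqVneq x 1; first by rewrite ln1 subrr.
exact/ltW/ln_lt_subr1.
Qed.

Lemma measurable_invr (R : realType) :
  measurable_fun [set: R] (fun x : R => x^-1).
Proof.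
(* Away from [0] the inverse is expressed through [expR] and [ln]; the last branch is the convention
   [0^-1 = 0]. *)
rewrite (_ : (fun _ => _) = (fun x : R =>
    if 0 < x then expR (- ln x) else
    if x < 0 then - expR (- ln (- x)) else 0)); last first.
  apply/funext => x; case: ltgtP => [x0|x0|<-]; last by rewrite invr0.
    by rewrite expRN lnK ?posrE.
  by rewrite expRN lnK ?posrE ?oppr_gt0// invrN opprK.
have mN : measurable_fun [set: R] (fun x : R => expR (- ln x)).
  by apply: measurableT_comp => //; apply: measurable_funN.
apply: measurable_fun_ifT => //; first exact: measurable_fun_ltr.
apply: measurable_fun_ifT => //; [exact: measurable_fun_ltr|].
by apply: measurable_funN; apply: (measurableT_comp mN); apply: measurable_funN.
Qed.

Lemma measurable_lne_EFin (R : realType) :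
  measurable_fun [set: R] (fun r : R => lne r%:E).
Proof.
apply: measurable_fun_ifT => //; first exact: measurable_fun_ler.
by apply/measurable_EFinP; exact: measurable_ln.
Qed.

(* No integrability is needed, because [oo - oo = -oo] in [\bar R]. *)
Lemma le_integral_measurable d (T : measurableType d) (R : realType)
    (mu : {measure set T -> \bar R}) (f g : T -> \bar R) :
  measurable_fun setT f -> measurable_fun setT g -> (forall x, f x <= g x)%E ->
  (\int[mu]_x f x <= \int[mu]_x g x)%E.
Proof.
move=> mf mg fg.
have fgT : {in [set: T], forall x, f x <= g x}%E by move=> x _; exact: fg.
rewrite integralE [leRHS]integralE; apply: leeB.
  apply: ge0_le_integral => //.
  - exact: measurable_funepos.
  - exact: measurable_funepos.
  - by move=> x _; exact: (funepos_le fgT (in_setT x)).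
apply: ge0_le_integral => //.
- exact: measurable_funeneg.
- exact: measurable_funeneg.
- by move=> x _; exact: (funeneg_le fgT (in_setT x)).
Qed.

(** The difference [g - f] is nonnegative with integral zero. The subtraction is legitimate because
    [f], having the finite integral of [g], is itself integrable. *)
Lemma le_integral_eq_ae d (T : measurableType d) (R : realType)
    (mu : {measure set T -> \bar R}) (f : T -> \bar R) (g : T -> R) :
  measurable_fun setT f -> mu.-integrable setT (EFin \o g) ->
  (forall x, f x <= (g x)%:E)%E ->
  (\int[mu]_x f x = \int[mu]_x (g x)%:E)%E ->
  {ae mu, forall x, f x = (g x)%:E}.
Proof.
move=> mf ig fg fgE.
have if_ : mu.-integrable setT f.
  apply/integrableP; split => //; apply/abse_integralP => //.
  by rewrite fgE; apply/abse_integralP => //; case/integrableP: ig.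
have igf := integrableB measurableT ig if_.
have := @integralB _ _ _ mu _ measurableT _ _ ig if_.
rewrite fgE subee; last exact: integrable_fin_num.
have gf0 x : (0 <= ((EFin \o g) \- f) x)%E.
  by rewrite /= sube_ge0 ?orbT//; exact: fg.
rewrite (eq_integral (fun x => `|((EFin \o g) \- f) x|%E)); last first.
  by move=> x _; rewrite gee0_abs.
move/(ae_eq_integral_abs mu measurableT (measurable_int _ igf)).
apply: filterS => x /(_ I) /=; case: (f x) => // r.
by rewrite -EFinB => -[] /eqP; rewrite subr_eq0 => /eqP ->.
Qed.

(** A term [X i = -oo] would pull the whole sum of [X] below the finite sum of [Y]. So all terms are
    finite, and one strict inequality would make the sums strictly ordered. *)
Lemma sume_le_eq (R : realType) n (X Y : 'I_n -> \bar R) :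
  (forall j, X j <= Y j)%E -> (forall j, Y j \is a fin_num) ->
  (\sum_(j < n) Y j <= \sum_(j < n) X j)%E -> forall j, X j = Y j.
Proof.
move=> XY fY YX.
have fYs : (\sum_(j < n) Y j)%E \is a fin_num.
  by apply/sum_fin_numP => i _ _; exact: fY.
have fX i : X i \is a fin_num.
  rewrite fin_numE -!ltey -ltNye (le_lt_trans (XY i)) ?ltey_eq ?fY// andbT.
  rewrite ltNye; apply/eqP => XiNy; move: YX; rewrite leNgt => /negP; apply.
  rewrite (_ : (\sum_(j < n) X j)%E = -oo%E) ?ltNye_eq ?fYs//.
  by apply/eqP; rewrite esum_eqNy; apply/existsP; exists i; rewrite XiNy eqxx.
move=> j; apply/eqP; rewrite eq_le XY /= leNgt; apply/negP => ltXY.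
move: YX; apply/negP; rewrite -ltNge (bigD1 j)//= [ltRHS](bigD1 j)//=.
apply: lte_leD => //; last by apply: lee_sum => i _; exact: XY.
by apply/sum_fin_numP => i _ _; exact: fX.
Qed.

(** * Pointwise theory of the divergence integrand *)

(** Real-valued integrand of [KL]. Since [p / 0 = 0] and [ln 0 = 0], it is [0] instead of [+oo]
    where [q = 0 < p]; hence the recurring hypothesis [q = 0 -> p = 0]. *)
Definition xlog (R : realType) (p q : R) : R := p * ln (p / q).

Lemma gt0_dominated (R : realType) (p q : R) : 0 < p -> 0 <= q ->
  (q = 0 -> p = 0) -> 0 < q.
Proof.
move=> p0 q0 qp; rewrite lt_neqAle q0 andbT.
by apply: contraTneq p0 => /esym/qp ->; rewrite ltxx.
Qed.

(** This is [ln u <= u - 1] at [u = q / p], multiplied by [- p]. *)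
Lemma xlog_ge (R : realType) (p q : R) : 0 <= p -> 0 <= q ->
  (q = 0 -> p = 0) -> p - q <= xlog p q.
Proof.
rewrite /xlog le_eqVlt => /predU1P[<-|p0] q0 qp.
  by rewrite mul0r sub0r oppr_le0.
have {}q0 := gt0_dominated p0 q0 qp.
have := ln_le_subr1 (divr_gt0 q0 p0).
rewrite -[p / q]invf_div lnV ?posrE ?divr_gt0// => h.
rewrite mulrN lerNr opprB.
apply: (le_trans (ler_wpM2l (ltW p0) h)).
by rewrite mulrBr mulr1 mulrC divfK ?gt_eqF.
Qed.

Lemma xlog_le0 (R : realType) (p s : R) : 0 <= p -> p <= s -> xlog p s <= 0.
Proof.
move=> p0 ps; apply: mulr_ge0_le0 => //; apply: ln_le0.
have [s0|] := ltP 0 s; first by rewrite ler_pdivrMr ?mul1r.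
by move=> s0; rewrite (le_trans _ ler01)// mulr_ge0_le0 ?invr_le0.
Qed.

(** From [p - s <= xlog p s <= 0]. It makes [xlog p s] integrable as soon as [s] is. *)
Lemma normr_xlog_le (R : realType) (p s : R) :
  0 <= p -> p <= s -> `|xlog p s| <= s.
Proof.
move=> p0 ps; have s0 := le_trans p0 ps.
rewrite ler0_norm ?xlog_le0// lerNl (le_trans _ (xlog_ge p0 s0 _))//.
  by rewrite lerBrDr addNr.
by move=> sE; apply/eqP; rewrite eq_le p0 -sE ps.
Qed.

Lemma xlogM (R : realType) (a p q : R) : a != 0 ->
  xlog (a * p) (a * q) = a * xlog p q.
Proof. by move=> a0; rewrite /xlog -mulf_div divff// mul1r mulrA. Qed.

Lemma xlogMr (R : realType) (c p q : R) : 0 < c -> 0 <= p -> 0 <= q ->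
  (q = 0 -> p = 0) -> xlog p q = xlog p (c * q) + p * ln c.
Proof.
rewrite /xlog => c0; rewrite le_eqVlt => /predU1P[<-|p0] q0 qp.
  by rewrite !mul0r addr0.
have {}q0 := gt0_dominated p0 q0 qp.
rewrite -mulrDr -lnM ?posrE ?divr_gt0 ?mulr_gt0//; congr (_ * ln _).
by field; rewrite !gt_eqF.
Qed.

Lemma mule_lne_div (R : realType) (p q : R) : 0 <= p -> 0 <= q ->
  (q = 0 -> p = 0) -> (p%:E * lne (p%:E / q%:E) = (xlog p q)%:E)%E.
Proof.
rewrite /xlog le_eqVlt => /predU1P[<-|p0] q0 qp.
  by rewrite mul0e mul0r.
have {}q0 := gt0_dominated p0 q0 qp.
by rewrite inver gt_eqF// -EFinM lne_EFin ?divr_gt0.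
Qed.

(** Factor [D = (p / s) * (s * D / p)]; the second factor is the [u] to which [ln u <= u - 1] is
    applied. *)
Lemma mulr_ln_xlog (R : realType) (p s D : R) : 0 < p -> 0 < s -> 0 < D ->
  p * ln D = xlog p s + p * ln (s * D / p).
Proof.
move=> p0 s0 D0; rewrite /xlog -mulrDr -lnM ?posrE ?divr_gt0 ?mulr_gt0//.
by congr (_ * ln _); field; rewrite !gt_eqF.
Qed.

Lemma mule_lne_le (R : realType) (p s D : R) : 0 <= p -> p <= s -> 0 <= D ->
  (p%:E * lne D%:E <= (xlog p s + (s * D - p))%:E)%E.
Proof.
rewrite le_eqVlt => /predU1P[<-|p0] ps.
  by move=> D0; rewrite mul0e lee_fin /xlog mul0r add0r subr0 mulr_ge0.
have s0 := lt_le_trans p0 ps.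
rewrite le_eqVlt => /predU1P[<-|D0].
  by rewrite le0_lneNy// gt0_muleNy ?leNye.
rewrite lne_EFin// -EFinM lee_fin (mulr_ln_xlog p0 s0 D0) lerD2l.
have := ln_le_subr1 (divr_gt0 (mulr_gt0 s0 D0) p0).
by rewrite -(ler_pM2l p0 (ln _)) mulrBr mulr1 [p * (_ / p)]mulrC divfK ?gt_eqF.
Qed.

Lemma mule_lne_eq (R : realType) (p s D : R) : 0 <= p -> p <= s -> 0 <= D ->
  (p%:E * lne D%:E = (xlog p s + (s * D - p))%:E)%E -> s * D = p.
Proof.
rewrite le_eqVlt => /predU1P[<-|p0] ps.
  by move=> D0; rewrite mul0e /xlog mul0r add0r subr0 => -[].
have s0 := lt_le_trans p0 ps.
(* For [D = 0 < p] the left side is [-oo], so equality with a real is impossible. *)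
rewrite le_eqVlt => /predU1P[<-|D0]; first by rewrite le0_lneNy// gt0_muleNy.
rewrite lne_EFin// -EFinM (mulr_ln_xlog p0 s0 D0) => -[] /addrI h.
apply/eqP/negPn/negP => sDp; move: h; apply/eqP; rewrite lt_eqF//.
have sDp1 : s * D / p != 1.
  by apply: contra sDp => /eqP/(divr1_eq) ->.
have := ln_lt_subr1 (divr_gt0 (mulr_gt0 s0 D0) p0) sDp1.
by rewrite -(ltr_pM2l p0 (ln _)) mulrBr mulr1 [p * (_ / p)]mulrC divfK ?gt_eqF.
Qed.

(** * Integrability and the Kullback-Leibler divergence *)

Lemma density_integrable d (T : measurableType d) (R : realType)
    (mu : {measure set T -> \bar R}) (p : T -> R) :
  is_density mu p -> mu.-integrable setT (EFin \o p).
Proof.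
move=> [mp p0 p1]; apply/integrableP; split; first exact/measurable_EFinP.
rewrite (eq_integral (EFin \o p)) ?p1 ?ltry// => x _ /=.
by rewrite ger0_norm.
Qed.

Lemma measurable_xlog d (T : measurableType d) (R : realType) (p q : T -> R) :
  measurable_fun setT p -> measurable_fun setT q ->
  measurable_fun setT (fun x => xlog (p x) (q x)).
Proof.
move=> mp mq; apply: measurable_funM => //.
apply: (measurableT_comp (@measurable_ln R)); apply: measurable_funM => //.
exact: (measurableT_comp (@measurable_invr R)).
Qed.

Lemma integrable_xlog d (T : measurableType d) (R : realType)
    (mu : {measure set T -> \bar R}) (p s : T -> R) :
  measurable_fun setT p -> mu.-integrable setT (EFin \o s) ->
  (forall x, 0 <= p x <= s x) ->
  mu.-integrable setT (fun x => (xlog (p x) (s x))%:E).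
Proof.
move=> mp is_ ps; have ms : measurable_fun setT s.
  by apply/measurable_EFinP; exact: measurable_int is_.
apply: (le_integrable measurableT _ _ is_).
  by apply/measurable_EFinP; exact: measurable_xlog.
move=> x _ /=; have /andP[p0 pxs] := ps x.
by rewrite lee_fin [leRHS]ger0_norm ?normr_xlog_le// (le_trans p0).
Qed.

(** Domination forces [p] to vanish wherever [q] does, so the integrand never takes the value
    [+oo]. *)
Lemma KL_dominated d (T : measurableType d) (R : realType)
    (mu : {measure set T -> \bar R}) (p q : T -> R) (c : R) : 0 < c ->
  (forall x, 0 <= p x <= c * q x) ->
  KL mu p q = (\int[mu]_x (xlog (p x) (q x))%:E)%E.
Proof.
move=> c0 pq; apply: eq_integral => x _; have /andP[p0 pcq] := pq x.
have q0 : 0 <= q x by rewrite -(pmulr_rge0 _ c0) (le_trans p0).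
rewrite mule_lne_div//.
by move=> qx0; apply/eqP; rewrite eq_le p0 andbT -(mulr0 c) -qx0.
Qed.

(** Gibbs' inequality: integrate [p - q <= xlog p q], whose left side has integral [1 - 1]. *)
Lemma KL_ge0 d (T : measurableType d) (R : realType)
    (mu : {measure set T -> \bar R}) (p q : T -> R) (c : R) : 0 < c ->
  is_density mu p -> is_density mu q -> (forall x, p x <= c * q x) ->
  (0 <= KL mu p q)%E.
Proof.
move=> c0 dp dq pq; have [mp p0 p1] := dp; have [mq q0 q1] := dq.
rewrite (KL_dominated mu c0) => [|x]; last by rewrite p0 pq.
have -> : 0%E = (\int[mu]_x ((p x)%:E - (q x)%:E))%E.
  by rewrite integralB_EFin ?p1 ?q1 ?subee//; exact: density_integrable.
apply: le_integral_measurable => [||x].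
- by apply: emeasurable_funB; exact/measurable_EFinP.
- by apply/measurable_EFinP; exact: measurable_xlog.
- rewrite -EFinB lee_fin xlog_ge// => qx0.
  by apply/eqP; rewrite eq_le p0 andbT -(mulr0 c) -qx0.
Qed.

Lemma KL_eq0 d (T : measurableType d) (R : realType)
    (mu : {measure set T -> \bar R}) (p q : T -> R) (c : R) : 0 < c ->
  measurable_fun setT p -> measurable_fun setT q ->
  (forall x, 0 <= p x <= c * q x) -> {ae mu, forall x, p x = q x} ->
  KL mu p q = 0%E.
Proof.
move=> c0 mp mq pq pqE; rewrite (KL_dominated mu c0)//.
rewrite (ae_eq_integral (cst 0%E)) ?integral0//.
  by apply/measurable_EFinP; exact: measurable_xlog.
apply: filterS pqE => x pqx _; rewrite /xlog -pqx /=.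
by have [->|p0] := eqVneq (p x) 0; rewrite ?mul0r// divff// ln1 mulr0.
Qed.

Lemma measurable_mule_lne d (T : measurableType d) (R : realType)
    (p D : T -> R) :
  measurable_fun setT p -> measurable_fun setT D ->
  measurable_fun setT (fun x => (p x)%:E * lne (D x)%:E)%E.
Proof.
move=> mp mD; apply: emeasurable_funM; first exact/measurable_EFinP.
exact: (measurableT_comp (@measurable_lne_EFin R)).
Qed.

(** * The joint family of densities and its optimal discriminators *)

(** One family indexed like the discriminator components, so that data and generators are treated
    symmetrically. *)
Definition joint (T : Type) (R : realType) (k : nat) (pd : T -> R)
    (pg : 'I_k -> T -> R) (j : 'I_k.+1) : T -> R :=
  oapp pg pd (unlift ord_max j).

Lemma joint_max (T : Type) (R : realType) (k : nat) (pd : T -> R)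
  (pg : 'I_k -> T -> R) : joint pd pg ord_max = pd.
Proof. by rewrite /joint unlift_none. Qed.

Lemma joint_lift (T : Type) (R : realType) (k : nat) (pd : T -> R)
  (pg : 'I_k -> T -> R) i : joint pd pg (lift ord_max i) = pg i.
Proof. by rewrite /joint liftK. Qed.

Lemma sum_joint (T : Type) (R : realType) (k : nat) (pd : T -> R)
    (pg : 'I_k -> T -> R) x :
  \sum_(j < k.+1) joint pd pg j x = pd x + \sum_(i < k) pg i x.
Proof.
rewrite (bigD1_ord ord_max)//= joint_max; congr (_ + _).
by apply: eq_bigr => i _; rewrite joint_lift.
Qed.

Lemma joint_density d (T : measurableType d) (R : realType)
    (mu : {measure set T -> \bar R}) (k : nat) (pd : T -> R)
    (pg : 'I_k -> T -> R) : is_density mu pd ->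
  (forall i, is_density mu (pg i)) -> forall j, is_density mu (joint pd pg j).
Proof. by move=> ? ? j; rewrite /joint; case: unlift. Qed.

Lemma discriminator_objectiveE d (T : measurableType d) (R : realType)
    (mu : {measure set T -> \bar R}) (k : nat) (pd : T -> R)
    (pg : 'I_k -> T -> R) (D : 'I_k.+1 -> T -> R) :
  discriminator_objective mu pd pg D =
  (\sum_(j < k.+1) expect mu (joint pd pg j) (fun x => lne (D j x)%:E))%E.
Proof.
rewrite (bigD1_ord ord_max)//= joint_max; congr (_ + _)%E.
by apply: eq_bigr => i _; rewrite joint_lift.
Qed.

(* Where all densities vanish, any probability vector would do. *)
Definition bayes_discriminator (T : Type) (R : realType) (k : nat)
    (p : 'I_k.+1 -> T -> R) (j : 'I_k.+1) (x : T) : R :=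
  let s := \sum_(i < k.+1) p i x in
  if s == 0 then (j == ord_max)%:R else p j x / s.

Section OptimalDiscriminator.
Context d (T : measurableType d) (R : realType)
    (mu : {measure set T -> \bar R}) (k : nat) (p : 'I_k.+1 -> T -> R).
Hypothesis dp : forall j, is_density mu (p j).
Let s x := \sum_(j < k.+1) p j x.

Lemma sum_density_integrable : mu.-integrable setT (EFin \o s).
Proof.
rewrite (_ : EFin \o s = fun x => \sum_(j < k.+1) (p j x)%:E)%E.
  by apply: integrable_sum => // j _; exact: density_integrable.
by apply/funext => x /=; rewrite sumEFin.
Qed.

Lemma density_le_sum j x : 0 <= p j x <= s x.
Proof.
have p0 i y : 0 <= p i y by case: (dp i).
by rewrite p0 /s (bigD1 j)//= lerDl sumr_ge0.
Qed.

Lemma bayes_is_discriminator : is_discriminator (bayes_discriminator p).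
Proof.
have ms : measurable_fun setT s.
  by apply/measurable_EFinP; exact: measurable_int sum_density_integrable.
split=> [j|j x|x].
- apply: measurable_fun_ifT => //; first exact: measurable_fun_eqr.
  apply: measurable_funM; first by case: (dp j).
  exact: (measurableT_comp (@measurable_invr R)).
- rewrite /bayes_discriminator -/(s x); case: eqP => [_|/eqP s0].
    by case: eqP; rewrite !lexx ler01.
  have /andP[p0 ps] := density_le_sum j x; have s_ge0 := le_trans p0 ps.
  by rewrite divr_ge0//= ler_pdivrMr ?mul1r// lt_neqAle eq_sym s0.
- rewrite /bayes_discriminator -/(s x); case: eqP => [_|/eqP s0].
    rewrite (bigD1 ord_max)//= eqxx big1 ?addr0// => i /negPf ->//.
  by rewrite -mulr_suml -/(s x) divff.
Qed.

(** Points with [s x = 0] also have [p j x = 0], so the arbitrary value of the discriminator there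
    carries no weight. *)
Lemma expect_bayes j :
  expect mu (p j) (fun x => lne (bayes_discriminator p j x)%:E) =
  (\int[mu]_x (xlog (p j x) (s x))%:E)%E.
Proof.
apply: eq_integral => x _; rewrite /bayes_discriminator -/(s x).
have /andP[] := density_le_sum j x; rewrite /xlog.
rewrite le_eqVlt => /predU1P[<-|p0] ps; first by rewrite mul0e mul0r.
have s0 := lt_le_trans p0 ps.
by rewrite gt_eqF// lne_EFin// divr_gt0.
Qed.

Lemma integrable_xlog_sum j :
  mu.-integrable setT (fun x => (xlog (p j x) (s x))%:E).
Proof.
apply: integrable_xlog; [by case: (dp j)|exact: sum_density_integrable|].
exact: density_le_sum.
Qed.

Variable D : 'I_k.+1 -> T -> R.
Hypothesis dD : is_discriminator D.

Let slack j x := s x * D j x - p j x.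

Lemma integrable_slack j : mu.-integrable setT (EFin \o slack j).
Proof.
have [mD D01 _] := dD.
have isD : mu.-integrable setT (EFin \o (fun x => s x * D j x)).
  apply: (le_integrable measurableT _ _ sum_density_integrable).
    apply/measurable_EFinP; apply: measurable_funM => //.
    by apply/measurable_EFinP; exact: measurable_int sum_density_integrable.
  move=> x _ /=; have /andP[D0 D1] := D01 j x.
  by rewrite lee_fin normrM ler_piMr// ger0_norm.
exact: (integrableB measurableT isD (density_integrable (dp j))).
Qed.

Lemma integrable_bound j :
  mu.-integrable setT (EFin \o (fun x => xlog (p j x) (s x) + slack j x)).
Proof.
exact: (integrableD measurableT (integrable_xlog_sum j) (integrable_slack j)).
Qed.

(** Pointwise, the slacks add up to [s * 1 - s = 0]. *)
Lemma sum_bound :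
  (\sum_(j < k.+1) \int[mu]_x (xlog (p j x) (s x) + slack j x)%:E =
   \sum_(j < k.+1) \int[mu]_x (xlog (p j x) (s x))%:E)%E.
Proof.
have [_ _ D1] := dD.
rewrite -integral_sum; [|exact: measurableT|exact: integrable_bound].
rewrite -integral_sum; [|exact: measurableT|exact: integrable_xlog_sum].
apply: eq_integral => x _; rewrite !sumEFin big_split/= sumrB -mulr_sumr D1.
by rewrite mulr1 subrr addr0.
Qed.

Lemma expect_discriminator_le j :
  (expect mu (p j) (fun x => lne (D j x)%:E) <=
   \int[mu]_x (xlog (p j x) (s x) + slack j x)%:E)%E.
Proof.
have [mD D01 _] := dD.
apply: le_integral_measurable => [||x].
- by apply: measurable_mule_lne; [case: (dp j)|].
- exact: measurable_int (integrable_bound j).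
- have /andP[p0 ps] := density_le_sum j x; have /andP[D0 _] := D01 j x.
  exact: mule_lne_le.
Qed.

(** The hypothesis says that [D] does at least as well as the Bayes discriminator. By [sum_bound]
    every termwise bound is then attained in integral, hence almost everywhere, and [mule_lne_eq]
    applies. *)
Lemma optimal_discriminator_ae :
  (\sum_(j < k.+1) \int[mu]_x (xlog (p j x) (s x))%:E <=
   \sum_(j < k.+1) expect mu (p j) (fun x => lne (D j x)%:E))%E ->
  forall j, {ae mu, forall x, s x * D j x = p j x}.
Proof.
have [mD D01 _] := dD.
rewrite -sum_bound => /(sume_le_eq expect_discriminator_le) E j.
have {}E := E (fun j => integrable_fin_num measurableT (integrable_bound j)) j.
have := le_integral_eq_ae _ (integrable_bound j) _ E.
have mX : measurable_fun setT (fun x => (p j x)%:E * lne (D j x)%:E)%E.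
  by apply: measurable_mule_lne; [case: (dp j)|].
move=> /(_ mX); have ple x := density_le_sum j x.
have XY x : ((p j x)%:E * lne (D j x)%:E <=
    (xlog (p j x) (s x) + slack j x)%:E)%E.
  have /andP[p0 ps] := ple x; have /andP[D0 _] := D01 j x; exact: mule_lne_le.
move=> /(_ XY); apply: filterS => x.
by have /andP[p0 ps] := ple x; have /andP[D0 _] := D01 j x; exact: mule_lne_eq.
Qed.
End OptimalDiscriminator.

(** Serves twice: with [q = p = pd] for the data component, and with [q = pg i], [p = \sum_i pg i]
    for its complement to [1]. *)
Lemma mule_lne_ratio (R : realType) (q p s D : R) :
  0 <= q -> q <= p -> p <= s -> s * D = p ->
  (q%:E * lne D%:E = (q * ln (p / s))%:E)%E.
Proof.
rewrite le_eqVlt => /predU1P[<-|q0] qp ps sD; first by rewrite mul0e mul0r.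
have p0 := lt_le_trans q0 qp; have s0 := lt_le_trans p0 ps.
have -> : D = p / s by rewrite -sD mulrC mulKf ?gt_eqF.
by rewrite lne_EFin ?divr_gt0.
Qed.

Lemma bayes_optimal d (T : measurableType d) (R : realType)
    (mu : {measure set T -> \bar R}) (k : nat) (pd : T -> R)
    (pg : 'I_k -> T -> R) :
  is_density mu pd -> (forall i, is_density mu (pg i)) ->
  is_optimal_discriminator mu pd pg (bayes_discriminator (joint pd pg)).
Proof.
move=> hd hg; have dj := joint_density hd hg.
split=> [|D dD]; first exact: bayes_is_discriminator dj.
rewrite !discriminator_objectiveE.
under [leRHS]eq_bigr do rewrite (expect_bayes dj).
rewrite -(sum_bound dj dD); apply: lee_sum => j _.
exact: expect_discriminator_le.
Qed.

(** The identity is multiplied out because optimality leaves [D] undetermined where all densities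
    vanish. *)
Lemma optimal_ae d (T : measurableType d) (R : realType)
    (mu : {measure set T -> \bar R}) (k : nat) (pd : T -> R)
    (pg : 'I_k -> T -> R) (D : 'I_k.+1 -> T -> R) :
  is_density mu pd -> (forall i, is_density mu (pg i)) ->
  is_optimal_discriminator mu pd pg D ->
  {ae mu, forall x, (pd x + \sum_(i < k) pg i x) * D ord_max x = pd x}.
Proof.
move=> hd hg [dD optD]; have dj := joint_density hd hg.
have := optD _ (bayes_is_discriminator dj).
rewrite !discriminator_objectiveE.
under [leLHS]eq_bigr do rewrite (expect_bayes dj).
move=> /(optimal_discriminator_ae dj dD) /(_ ord_max).
by apply: filterS => x; rewrite sum_joint joint_max.
Qed.

(** * Mixtures and rescaling of the divergence *)

Lemma mean_density d (T : measurableType d) (R : realType)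
    (mu : {measure set T -> \bar R}) (n : nat) (p : 'I_n -> T -> R) :
  (0 < n)%N -> (forall i, is_density mu (p i)) -> is_density mu (gen_mean p).
Proof.
move=> n0 dp; split.
- apply: measurable_funM => //; apply: measurable_sum => i.
  by case: (dp i).
- move=> x; rewrite mulr_ge0 ?invr_ge0// sumr_ge0// => i _.
  by case: (dp i).
- rewrite (eq_integral (fun x => (n%:R^-1)%:E * \sum_(i < n) (p i x)%:E))%E.
    have ip i := density_integrable (dp i).
    rewrite integralZl//; last by apply: integrable_sum => // i _; exact: ip.
    rewrite integral_sum// (eq_bigr (fun=> 1%:E)); last first.
      by move=> i _; case: (dp i).
    by rewrite sumEFin sumr_const card_ord -EFinM mulVf ?pnatr_eq0 -?lt0n.
  by move=> x _; rewrite sumEFin -EFinM.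
Qed.

Lemma p_avgE (T : Type) (R : realType) (k : nat) (pd : T -> R)
  (pg : 'I_k -> T -> R) : p_avg pd pg = gen_mean (joint pd pg).
Proof. by apply/funext => x; rewrite /gen_mean sum_joint mulrC. Qed.

(** Meant for [q = p_avg]: the factors [c = k + 1] and [c = (k + 1) / k] turn [c * q] into [s] and
    [s / k]. As [p] has mass one, [ln c] integrates to itself. *)
Lemma KL_scale d (T : measurableType d) (R : realType)
    (mu : {measure set T -> \bar R}) (p q : T -> R) (c : R) : 0 < c ->
  is_density mu p -> mu.-integrable setT (EFin \o q) ->
  (forall x, p x <= c * q x) ->
  KL mu p q = (\int[mu]_x (xlog (p x) (c * q x))%:E + (ln c)%:E)%E.
Proof.
move=> c0 dp iq pq; have [mp p0 p1] := dp.
have pcq x : 0 <= p x <= c * q x by rewrite p0 pq.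
have icq : mu.-integrable setT (EFin \o (fun x => c * q x)).
  exact: (integrableZl measurableT c iq).
have ip := density_integrable dp.
rewrite (KL_dominated mu c0 pcq) -[X in (_ + X)%E]mule1 -p1 -integralZl//.
rewrite -integralD//; last 2 first.
- exact: integrable_xlog.
- exact: integrableZl.
apply: eq_integral => x _ /=; rewrite -EFinM -EFinD; congr EFin.
have q0 : 0 <= q x by rewrite -(pmulr_rge0 _ c0) (le_trans (p0 x)).
rewrite (xlogMr c0)//; first by rewrite [ln c * _]mulrC.
by move=> qx0; apply/eqP; rewrite eq_le p0 andbT -(mulr0 c) -qx0.
Qed.

(** * The generator objective at an optimal discriminator *)

Section Generators.
Context d (T : measurableType d) (R : realType)
    (mu : {measure set T -> \bar R}) (k : nat) (pd : T -> R)
    (pg : 'I_k -> T -> R).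
Hypotheses (hk : (0 < k)%N) (hd : is_density mu pd)
  (hg : forall i, is_density mu (pg i)).
Let G x := \sum_(i < k) pg i x.
Let s x := pd x + G x.
Let dj := joint_density hd hg.

Let pg_ge0 i x : 0 <= pg i x. Proof. by case: (hg i). Qed.
Let pd_ge0 x : 0 <= pd x. Proof. by case: hd. Qed.
Let pg_le i x : pg i x <= G x.
Proof. by rewrite /G (bigD1 i)//= lerDl sumr_ge0. Qed.
Let G_ge0 x : 0 <= G x. Proof. exact: sumr_ge0. Qed.
Let G_le x : G x <= s x. Proof. by rewrite lerDr. Qed.
Let pd_le x : pd x <= s x. Proof. by rewrite lerDl. Qed.
Let k0 : 0 < k%:R :> R. Proof. by rewrite ltr0n. Qed.

Let integrable_s : mu.-integrable setT (EFin \o s).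
Proof.
have := sum_density_integrable dj.
by congr (mu.-integrable _ _); apply/funext => x /=; rewrite sum_joint.
Qed.

Let measurable_s : measurable_fun setT s.
Proof. by apply/measurable_EFinP; exact: measurable_int integrable_s. Qed.

Let measurable_pg i : measurable_fun setT (pg i). Proof. by case: (hg i). Qed.
Let measurable_pd : measurable_fun setT pd. Proof. by case: hd. Qed.
Let measurable_G : measurable_fun setT G. Proof. exact: measurable_sum. Qed.

Let integrable_xlog_pd : mu.-integrable setT (fun x => (xlog (pd x) (s x))%:E).
Proof. by apply: integrable_xlog => // x; rewrite pd_ge0 pd_le. Qed.

Let integrable_xlog_G : mu.-integrable setT (fun x => (xlog (G x) (s x))%:E).
Proof. by apply: integrable_xlog => // x; rewrite G_ge0 G_le. Qed.

(** Almost everywhere [s * D ord_max = pd], hence [s * (1 - D ord_max) = G]. The generator terms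
    thus share the factor [ln (G / s)], and their weights [pg i] add up to [G]. *)
Lemma generator_objective_optimal (D : 'I_k.+1 -> T -> R) :
  is_optimal_discriminator mu pd pg D ->
  generator_objective mu pd pg D =
  (\int[mu]_x (xlog (pd x) (s x))%:E + \int[mu]_x (xlog (G x) (s x))%:E)%E.
Proof.
move=> oD; have [[mD _ _] _] := oD; have sD := optimal_ae hd hg oD.
congr (_ + _)%E.
  apply: ae_eq_integral => //.
  - exact: measurable_mule_lne.
  - exact: measurable_int integrable_xlog_pd.
  - by apply: filterS sD => x sDx _; exact: mule_lne_ratio sDx.
have mq i : measurable_fun setT (fun x => (pg i x * ln (G x / s x))%:E).
  apply/measurable_EFinP; apply: measurable_funM => //.
  apply: (measurableT_comp (@measurable_ln R)); apply: measurable_funM => //.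
  exact: (measurableT_comp (@measurable_invr R)).
have iq i : mu.-integrable setT (fun x => (pg i x * ln (G x / s x))%:E).
  (* Since [0 <= pg i <= G], the integrand is dominated by [xlog G s]. *)
  apply: (le_integrable measurableT (mq i) _ integrable_xlog_G) => x _ /=.
  by rewrite lee_fin /xlog !normrM ler_wpM2r// !ger0_norm.
transitivity (\sum_(i < k) \int[mu]_x (pg i x * ln (G x / s x))%:E)%E.
  apply: eq_bigr => i _; apply: ae_eq_integral => //.
    by apply: measurable_mule_lne => //; exact: measurable_funB.
  apply: filterS sD => x sDx _; apply: mule_lne_ratio => //.
  by rewrite mulrBr mulr1 sDx /s addrC addKr.
rewrite -integral_sum//; apply: eq_integral => x _.
by rewrite sumEFin -mulr_suml.
Qed.

Let avgK x : k.+1%:R * p_avg pd pg x = s x.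
Proof. by rewrite mulrC divfK ?pnatr_eq0. Qed.

Let pd_le_avg x : pd x <= k.+1%:R * p_avg pd pg x.
Proof. by rewrite avgK. Qed.

Let mean_le_avg x : gen_mean pg x <= k.+1%:R / k%:R * p_avg pd pg x.
Proof.
by rewrite mulrAC avgK /gen_mean mulrC ler_wpM2r ?invr_ge0 ?ler0n ?G_le.
Qed.

Let c_gt0 : 0 < k.+1%:R / k%:R :> R. Proof. by rewrite divr_gt0. Qed.

Let avg_density : is_density mu (p_avg pd pg).
Proof. by rewrite p_avgE; exact: mean_density. Qed.

(** [KL_scale] contributes [ln (k + 1)] from the first divergence and, after the factor [k],
    [k * ln ((k + 1) / k)] from the second; the final constant cancels their sum. *)
Lemma generator_objectiveE (D : 'I_k.+1 -> T -> R) :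
  is_optimal_discriminator mu pd pg D ->
  generator_objective mu pd pg D =
  (KL mu pd (p_avg pd pg) + k%:R%:E * KL mu (gen_mean pg) (p_avg pd pg)
   + (- (k.+1%:R * ln k.+1%:R) + k%:R * ln k%:R)%R%:E)%E.
Proof.
move=> /generator_objective_optimal ->.
have iavg := density_integrable avg_density.
rewrite (KL_scale _ hd iavg pd_le_avg)//.
rewrite (KL_scale c_gt0 (mean_density hk hg) iavg mean_le_avg).
have -> : (\int[mu]_x (xlog (pd x) (k.+1%:R * p_avg pd pg x))%:E =
    \int[mu]_x (xlog (pd x) (s x))%:E)%E.
  by apply: eq_integral => x _; rewrite avgK.
(* Both arguments are [1 / k] times [G] and [s], so [xlogM] extracts this factor. *)
have -> : (\int[mu]_x (xlog (gen_mean pg x)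
      (k.+1%:R / k%:R * p_avg pd pg x))%:E =
    (k%:R^-1)%:E * \int[mu]_x (xlog (G x) (s x))%:E)%E.
  rewrite -integralZl//; apply: eq_integral => x _; rewrite -EFinM -xlogM.
    by rewrite mulrAC avgK [s x / _]mulrC.
  by rewrite invr_eq0 gt_eqF.
(* Both integrals are finite, which reduces the claim to an identity between reals. *)
rewrite -(fineK (integrable_fin_num measurableT integrable_xlog_pd)).
rewrite -(fineK (integrable_fin_num measurableT integrable_xlog_G)).
rewrite -!(EFinM, EFinD); congr EFin.
rewrite ln_div ?posrE//; field; exact: lt0r_neq0.
Qed.

Lemma generator_objective_ge (D : 'I_k.+1 -> T -> R) :
  is_optimal_discriminator mu pd pg D ->
  ((- (k.+1%:R * ln k.+1%:R) + k%:R * ln k%:R)%:E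
     <= generator_objective mu pd pg D)%E.
Proof.
move=> /generator_objectiveE ->; rewrite leeDr// adde_ge0 ?mule_ge0//.
  exact: KL_ge0 pd_le_avg.
exact: KL_ge0 c_gt0 (mean_density hk hg) avg_density mean_le_avg.
Qed.

Lemma generator_objective_mean (D : 'I_k.+1 -> T -> R) :
  is_optimal_discriminator mu pd pg D ->
  {ae mu, forall x, pd x = gen_mean pg x} ->
  generator_objective mu pd pg D =
  (- (k.+1%:R * ln k.+1%:R) + k%:R * ln k%:R)%:E.
Proof.
move=> /generator_objectiveE -> pdE; have [mm m0 _] := mean_density hk hg.
have [ma _ _] := avg_density.
(* Here [G = k * pd] gives [s = (k + 1) * pd]; data density, mean and average then coincide almost
   everywhere and both divergences vanish. *)
have avgE x : pd x = gen_mean pg x -> p_avg pd pg x = pd x.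
  move=> e; have Ge : G x = k%:R * pd x.
    by rewrite e mulrA divff ?mul1r// gt_eqF.
  by rewrite /p_avg -/(G x) Ge -[X in X + _]mul1r -mulrDl
    nat1r mulrC mulKf.
rewrite (@KL_eq0 _ _ _ mu pd _ k.+1%:R)//; last 2 first.
- by move=> x; rewrite pd_ge0 pd_le_avg.
- by apply: filterS pdE => x /avgE.
rewrite (KL_eq0 c_gt0 mm ma)//; last 2 first.
- by move=> x; rewrite m0 mean_le_avg.
- by apply: filterS pdE => x e; rewrite (avgE x e).
by rewrite mule0 !add0e.
Qed.
End Generators.

Theorem theorem1 (d : measure_display) (T : measurableType d) (R : realType)
    (mu : {sigma_finite_measure set T -> \bar R}) (k : nat) (hk : (1 <= k)%N)
    (pd : T -> R) (hpd : is_density mu pd) :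
  [/\ forall pg : 'I_k -> T -> R, (forall i, is_density mu (pg i)) ->
        exists D : 'I_k.+1 -> T -> R, is_optimal_discriminator mu pd pg D,
      forall (pg : 'I_k -> T -> R) (Dstar : 'I_k.+1 -> T -> R),
        (forall i, is_density mu (pg i)) ->
        is_optimal_discriminator mu pd pg Dstar ->
        generator_objective mu pd pg Dstar =
          (KL mu pd (p_avg pd pg) + k%:R%:E * KL mu (gen_mean pg) (p_avg pd pg)
           + (- (k.+1%:R * ln k.+1%:R) + k%:R * ln k%:R)%R%:E)%E
    & forall (pg : 'I_k -> T -> R) (Dstar : 'I_k.+1 -> T -> R),
        (forall i, is_density mu (pg i)) ->
        is_optimal_discriminator mu pd pg Dstar ->
        {ae mu, forall x, pd x = gen_mean pg x} ->
        generator_objective mu pd pg Dstar =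
          (- (k.+1%:R * ln k.+1%:R) + k%:R * ln k%:R)%:E /\
        forall (pg' : 'I_k -> T -> R) (Dstar' : 'I_k.+1 -> T -> R),
          (forall i, is_density mu (pg' i)) ->
          is_optimal_discriminator mu pd pg' Dstar' ->
          (generator_objective mu pd pg Dstar
             <= generator_objective mu pd pg' Dstar')%E].
Proof.
split=> [pg hg|pg D hg oD|pg D hg oD pdE].
- by exists (bayes_discriminator (joint pd pg)); exact: bayes_optimal.
- exact: generator_objectiveE.
- rewrite (generator_objective_mean hk hpd hg oD pdE).
  split=> // pg' D' hg' oD'.
  exact: generator_objective_ge.
Qed.
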